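(* Let $\Gamma=\Lambda\rtimes G$, let $\ell$ be a positive integer, and let $\mathcal{C}_\ell(\mathbb{R}^d)$ be the class of $\Gamma$-invariant subspaces of $L^2(\mathbb{R}^d)$ of length at most $\ell$. Let $\mathcal{F}=\{f_1,\dots,f_m\}\subseteq L^2(\mathbb{R}^d)$. For an arbitrary subspace $M\in\mathcal{C}_\ell(\mathbb{R}^d)$ there always exists a subspace $W\subseteq S_\Gamma(\mathcal{F})$ with $W\in\mathcal{C}_\ell(\mathbb{R}^d)$ such that $$\mathcal{E}(\mathcal{F},W)\le\mathcal{E}(\mathcal{F},M).$$
   Context: ''Subspace'' means closed subspace. $\Lambda$ is a full rank lattice in $\mathbb{R}^d$, and $G$ is a discrete countable group acting on $\mathbb{R}^d$ by continuous invertible automorphisms with $g\Lambda=\Lambda$ for all $g\in G$ (which implies that the Lebesgue measure of $\mathbb{R}^d$ is invariant under $G$); $\Gamma=\Lambda\rtimes G$ is the semidirect product. For $k\in\Lambda$, $g\in G$, $f\in L^2(\mathbb{R}^d)$, put $T_kf(x)=f(x-k)$ and $R_gf(x)=f(g^{-1}x)$. For a family $\mathcal{A}\subset L^2(\mathbb{R}^d)$, $S_\Gamma(\mathcal{A})=\overline{\mathrm{span}}\{T_kR_g f: k\in\Lambda,\ g\in G,\ f\in\mathcal{A}\}$. A closed subspace is $\Gamma$-invariant if it is invariant under all $T_kR_g$, $(k,g)\in\Gamma$; its length is the minimal number of functions $\psi_1,\dots,\psi_r$ such that it equals $S_\Gamma(\{\psi_1,\dots,\psi_r\})$. For a closed subspace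 $W$, with $\mathbb{P}_W$ the orthogonal projection onto $W$, $\mathcal{E}(\mathcal{F},W)=\sum_{i=1}^m\|f_i-\mathbb{P}_Wf_i\|^2$. *)

(* Defs.v *)
From HB Require Import structures.
From mathcomp Require Import all_boot all_order all_algebra.
From mathcomp Require Import all_classical all_reals all_analysis.
From mathcomp.real_closed Require Import complex.
Import Order.TTheory GRing.Theory Num.Theory.
Import numFieldNormedType.Exports.

Set Implicit Arguments.
Unset Strict Implicit.
Unset Printing Implicit Defensive.

Local Open Scope classical_set_scope.
Local Open Scope ring_scope.

(* 'rV[R]_n carries the sigma-algebra generated by the coordinates, which for
   R^n is the Borel one; the library has the same structure on n.-tuple. *)
Definition rV_display : measure_display.
Proof. exact: default_measure_display. Qed.

Section rV_measurable.
Context (R : realType) (n : nat).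

Let coord (i : 'I_n) (x : 'rV[R]_n) : measurableTypeR R := x ord0 i.

Let rV_set0 : g_sigma_preimage coord set0.
Proof. exact: sigma_algebra0. Qed.

Let rV_setC A : g_sigma_preimage coord A -> g_sigma_preimage coord (~` A).
Proof. exact: sigma_algebraC. Qed.

Let rV_bigcup (A : (set 'rV[R]_n)^nat) :
  (forall i, g_sigma_preimage coord (A i)) ->
  g_sigma_preimage coord (\bigcup_i A i).
Proof. exact: sigma_algebra_bigcup. Qed.

HB.instance Definition _ := @isMeasurable.Build rV_display 'rV[R]_n
  (g_sigma_preimage coord) rV_set0 rV_setC rV_bigcup.

Lemma measurable_rV_coord (i : 'I_n) :
  measurable_fun [set: 'rV[R]_n] (fun x => x ord0 i : measurableTypeR R).
Proof.
move=> _ Y mY; rewrite setTI; apply: sub_sigma_algebra => /=.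
rewrite -bigcup_seq/=; exists i => /=; first by rewrite mem_index_enum.
by exists Y => //; rewrite setTI.
Qed.

Lemma measurable_fun_rVP d (T : measurableType d) (f : T -> 'rV[R]_n) :
  (forall i, measurable_fun [set: T] (fun x => f x ord0 i : measurableTypeR R)) ->
  measurable_fun [set: T] f.
Proof.
move=> mf _ Y mY; rewrite setTI.
suff : g_sigma_preimage coord `<=` [set B | measurable (f @^-1` B)] by exact.
apply: smallest_sub.
  split=> /= [|A mA|A mA].
  - by rewrite preimage_set0.
  - by rewrite setTD preimage_setC; exact: measurableC.
  - by rewrite preimage_bigcup; exact: bigcupT_measurable.
rewrite -bigcup_seq; apply: bigcup_sub => i _ A [B mB <-] /=.
by rewrite setTI; have := mf i measurableT B mB; rewrite setTI.
Qed.

End rV_measurable.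

Definition rV_cons (R : realType) (n : nat)
    (p : measurableTypeR R * 'rV[R]_n) : 'rV[R]_n.+1 :=
  row_mx (const_mx p.1 : 'rV[R]_1) p.2.

Fixpoint lebesgue_rV (R : realType) (n : nat) : set 'rV[R]_n -> \bar R :=
  match n with
  | 0 => \d_(0 : 'rV[R]_0)
  | m.+1 => pushforward (lebesgue_measure \x @lebesgue_rV R m)%E (@rV_cons R m)
  end.

Arguments lebesgue_rV {R} n.

Section lebesgue_rV_measure.
Context (R : realType).

Lemma rV_consE n (p : measurableTypeR R * 'rV[R]_n) :
  (rV_cons p ord0 ord0 = p.1) *
  (forall j, rV_cons p ord0 (lift ord0 j) = p.2 ord0 j).
Proof.
split=> [|j]; rewrite mxE; case: splitP => k.
- by rewrite mxE.
- by [].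
- by case: k => -[].
- by move=> [jk]; congr (p.2 _ _); exact/val_inj.
Qed.

Lemma measurable_rV_cons n : measurable_fun setT (@rV_cons R n).
Proof.
apply: measurable_fun_rVP => i; case: (unliftP ord0 i) => [j|] ->.
  under eq_fun do rewrite rV_consE.
  exact: (measurableT_comp (measurable_rV_coord j) measurable_snd).
by under eq_fun do rewrite rV_consE; exact: measurable_fst.
Qed.

Let uncons n (x : 'rV[R]_n.+1) : measurableTypeR R * 'rV[R]_n :=
  (x ord0 ord0, \row_j x ord0 (lift ord0 j)).

Let unconsK n : cancel (@uncons n) (@rV_cons R n).
Proof.
move=> x; apply/rowP => i; case: (unliftP ord0 i) => [j|] ->.
  by rewrite rV_consE mxE.
by rewrite rV_consE.
Qed.

Let rV_consK n : cancel (@rV_cons R n) (@uncons n).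
Proof.
move=> [a v]; rewrite /uncons rV_consE; congr pair.
by apply/rowP => j; rewrite mxE rV_consE.
Qed.

Let measurable_uncons n : measurable_fun setT (@uncons n).
Proof.
apply: measurable_fun_pair; first exact: measurable_rV_coord.
apply: measurable_fun_rVP => i; under eq_fun do rewrite mxE.
exact: measurable_rV_coord.
Qed.

Section step.
Context (n : nat).
Variables (leb : {sigma_finite_measure set (measurableTypeR R) -> \bar R})
  (mu : {sigma_finite_measure set 'rV[R]_n -> \bar R}).

Let prod : {measure set _ -> \bar R} :=
  (leb \x mu)%E.

Let nu : set 'rV[R]_n.+1 -> \bar R :=
  pushforward prod (@rV_cons R n).

HB.instance Definition _ := Measure.copy nu
  (measure_function_pushforward__canonical__measure_function_Measure
     prod (@measurable_rV_cons n)).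

Let nu_sigma_finite : sigma_finite setT nu.
Proof.
have /sigma_finiteP[A [TA ndA Aoo]] := sigma_finiteT leb.
have /sigma_finiteP[B [TB ndB Boo]] := sigma_finiteT mu.
exists (fun k => @uncons n @^-1` (A k `*` B k)).
  rewrite -preimage_bigcup (_ : \bigcup_k _ = setT) ?preimage_setT//.
  rewrite -setXTT TA TB predeqE => -[x y]; split.
    by move=> [k _ []/= ? ?]; split; exists k.
  move=> [/= [i _ Aix] [k _ Bky]]; exists (maxn i k) => //; split.
  - by move: x Aix; exact/subsetPset/ndA/leq_maxl.
  - by move: y Bky; exact/subsetPset/ndB/leq_maxr.
move=> k; have [? ?] := Aoo k; have [? ?] := Boo k; split.
  rewrite -[X in measurable X]setTI; apply: measurable_uncons => //.
  exact: measurableX.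
rewrite /nu /pushforward -comp_preimage (_ : _ \o _ = id); last first.
  by apply/funext => p /=; exact: rV_consK.
by rewrite /= product_measure1E// lte_mul_pinfty// ge0_fin_numE.
Qed.

HB.instance Definition _ := Measure_isSigmaFinite.Build _ _ _ nu
  nu_sigma_finite.

Lemma rV_cons_sigma_finite_measure :
  exists m : {sigma_finite_measure set 'rV[R]_n.+1 -> \bar R},
    nu = m :> (set 'rV[R]_n.+1 -> \bar R).
Proof. by exists nu. Qed.

End step.

Lemma lebesgue_rV_sigma_finite_measure n :
  exists mu : {sigma_finite_measure set 'rV[R]_n -> \bar R},
    lebesgue_rV n = mu :> (set 'rV[R]_n -> \bar R).
Proof.
elim: n => [|n [mu /= ->]]; first by exists (\d_(0 : 'rV[R]_0)).
exact: (rV_cons_sigma_finite_measure (@lebesgue_measure R) mu).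
Qed.

Let leb0 n : @lebesgue_rV R n set0 = 0%E.
Proof. by have [mu ->] := lebesgue_rV_sigma_finite_measure n. Qed.

Let leb_ge0 n A : (0 <= @lebesgue_rV R n A)%E.
Proof. by have [mu ->] := lebesgue_rV_sigma_finite_measure n. Qed.

Let leb_sigma_additive n : semi_sigma_additive (@lebesgue_rV R n).
Proof.
have [mu ->] := lebesgue_rV_sigma_finite_measure n.
exact: measure_semi_sigma_additive.
Qed.

HB.instance Definition _ n := isMeasure.Build _ _ _ (@lebesgue_rV R n)
  (@leb0 n) (@leb_ge0 n) (@leb_sigma_additive n).

Let leb_sigma_finite n : sigma_finite setT (@lebesgue_rV R n).
Proof.
by have [mu ->] := lebesgue_rV_sigma_finite_measure n; exact: sigma_finiteT.
Qed.

HB.instance Definition _ n := Measure_isSigmaFinite.Build _ _ _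
  (@lebesgue_rV R n) (@leb_sigma_finite n).

Lemma lebesgue_rV_box n (a b : 'rV[R]_n) :
  (forall i, a ord0 i <= b ord0 i) ->
  lebesgue_rV n [set x | forall i, x ord0 i \in `[a ord0 i, b ord0 i]] =
    (\prod_(i < n) (b ord0 i - a ord0 i))%:E.
Proof.
elim: n a b => [|n IH] a b ab.
  set A := (X in lebesgue_rV 0 X); rewrite big_ord0 (_ : A = setT); first exact: diracT.
  by apply/seteqP; split => // x _ [].
set B := (X in lebesgue_rV n.+1 X); rewrite /= /pushforward.
pose a' : 'rV[R]_n := \row_j a ord0 (lift ord0 j).
pose b' : 'rV[R]_n := \row_j b ord0 (lift ord0 j).
pose B' := [set x : 'rV[R]_n | forall i, x ord0 i \in `[a' ord0 i, b' ord0 i]].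
have mB' : measurable B'.
  rewrite (_ : B' = \bigcap_(i in [set: 'I_n])
      ((fun x : 'rV[R]_n => x ord0 i) @^-1` `[a' ord0 i, b' ord0 i])).
    apply: fin_bigcap_measurable; first exact: finite_finset.
    move=> i _; rewrite -[X in measurable X]setTI.
    by apply: (measurable_rV_coord i measurableT); exact: measurable_itv.
  by apply/seteqP; split=> x Bx i; [move=> _; exact: Bx|exact: (Bx i)].
rewrite (_ : _ @^-1` B = `[a ord0 ord0, b ord0 ord0]%classic `*` B').
  rewrite product_measure1E//=.
  have /IH : forall i, a' ord0 i <= b' ord0 i by move=> i; rewrite !mxE.
  rewrite -/B' => ->; rewrite lebesgue_measure_itv/= lte_fin big_ord_recl EFinM.
  congr (_ * _%:E)%E; last by apply: eq_bigr => i _; rewrite !mxE.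
  case: ltP (ab ord0) => [_ _|h1 h2]; first by rewrite EFinB.
  by have /eqP -> : a ord0 ord0 == b ord0 ord0;
    rewrite ?subrr// eq_le h1 h2.
apply/seteqP; split=> [[t v] /= Bt|[t v] [/= tab vB] i].
  split; first by have := Bt ord0; rewrite rV_consE.
  by move=> i; rewrite !mxE; have := Bt (lift ord0 i); rewrite rV_consE.
case: (unliftP ord0 i) => [j|] ->; rewrite rV_consE//=.
by have := vB j; rewrite !mxE.
Qed.

End lebesgue_rV_measure.

Section L2.
Context (R : realType) (d : nat).

Local Notation fn := ('rV[R]_d -> R[i]).
Local Notation mu := (@lebesgue_rV R d).

Definition L2norm (f : fn) : \bar R :=
  'N[mu]_2%:E[EFin \o (fun x => Normc.normc (f x))].

(* L^2(R^d; C) is handled through representatives: its elements are functions,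
   and every closed subspace below is the set of all representatives of its
   elements (a set closed for the L^2 seminorm is stable under a.e. equality).
   Representatives are Borel; every Lebesgue measurable class has one. *)
Definition L2 : set fn := [set f : fn |
  [/\ measurable_fun setT (fun x => complex.Re (f x) : R),
      measurable_fun setT (fun x => complex.Im (f x) : R) &
      finite_norm mu 2%:E (fun x => Normc.normc (f x))]].

Definition L2inner (f g : fn) : R[i] :=
  Complex (\int[mu]_(x in setT) complex.Re (f x * conjc (g x)))
          (\int[mu]_(x in setT) complex.Im (f x * conjc (g x))).

Definition span (A : set fn) : set fn := [set h |
  exists n (c : 'I_n -> R[i]) (f : 'I_n -> fn),
    (forall i, A (f i)) /\ h = fun x => \sum_(i < n) c i * f i x].

Definition L2closure (A : set fn) : set fn := [set f |
  L2 f /\ forall e : R, 0 < e -> exists2 g, A g & (L2norm (f \- g)%R < e%:E)%E].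

Definition closed_subspace (W : set fn) : Prop :=
  [/\ W `<=` L2, W (cst 0),
      forall (c : R[i]) f g, W f -> W g -> W (fun x => c * f x + g x) &
      L2closure W `<=` W].

(* The projection is determined up to a.e. equality; [xget] fixes one
   representative. *)
Definition proj (W : set fn) (f : fn) : fn :=
  xget (cst 0) [set p | W p /\ forall w, W w -> L2inner (f \- p) w = 0].

Definition error m (f : 'I_m -> fn) (W : set fn) : \bar R :=
  (\sum_(i < m) L2norm (f i \- proj W (f i))%R ^+ 2)%E.

Definition full_rank_lattice (Lambda : set 'rV[R]_d) : Prop :=
  exists2 B : 'M[R]_d, B \in unitmx &
    Lambda = [set map_mx intr z *m B | z in [set: 'rV[int]_d]].

Definition T_op (k : 'rV[R]_d) (f : fn) : fn := fun x => f (x - k).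

Section action.
Context (Lambda : set 'rV[R]_d) (G : groupType) (rho : G -> 'rV[R]_d -> 'rV[R]_d).

(* An automorphism of R^d is one of its additive group; with continuity this
   makes it linear. Bijectivity follows from the first two clauses. *)
Record lattice_action : Prop := LatticeAction {
  action1 : forall x, rho 1%g x = x;
  actionM : forall g h x, rho (g * h)%g x = rho g (rho h x);
  action_additive : forall g x y, rho g (x + y) = rho g x + rho g y;
  action_continuous : forall g, continuous (rho g);
  action_lattice : forall g, rho g @` Lambda = Lambda }.

Definition R_op (g : G) (f : fn) : fn := fun x => f (rho g^-1%g x).

Definition S_Gamma (A : set fn) : set fn :=
  L2closure (span [set h | exists k g f,
    [/\ Lambda k, A f & h = T_op k (R_op g f)]]).

Definition Gamma_invariant (W : set fn) : Prop :=
  closed_subspace W /\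
  forall k g f, Lambda k -> W f -> W (T_op k (R_op g f)).

Definition generated_by (W : set fn) (r : nat) : Prop :=
  exists psi : 'I_r -> fn,
    (forall i, L2 (psi i)) /\ W = S_Gamma (range psi).

(* r is the least number of generators; the zero space has length 0. *)
Definition has_length (W : set fn) (r : nat) : Prop :=
  generated_by W r /\ forall s, generated_by W s -> (r <= s)%N.

Definition class_C (l : nat) : set (set fn) := [set W |
  Gamma_invariant W /\ exists2 r, has_length W r & (r <= l)%N].

End action.
End L2.

(* Main.v *)
Require Import Defs.
From mathcomp Require Import all_boot all_order all_algebra.
From mathcomp Require Import all_classical all_reals all_analysis.
From mathcomp.real_closed Require Import complex.
From mathcomp Require Import measurable_realfun ring lra.
Import Order.TTheory GRing.Theory Num.Theory.
Import numFieldNormedType.Exports.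

Local Open Scope classical_set_scope.
Local Open Scope ring_scope.

Set Implicit Arguments.
Unset Strict Implicit.
Unset Printing Implicit Defensive.

(** Let S be the Gamma-invariant space generated by the f_i, P the orthogonal
    projection onto S, and psi_1, ..., psi_r generators of M with r <= l. The
    space W generated by P psi_1, ..., P psi_r works. It lies in S because S is
    closed and invariant, and its length is at most r. Since P commutes with the
    operators U = T_k R_g, it maps M = S_Gamma(psi) into W [proj_S_Gamma]. Hence,
    if u is the projection of f_i onto M, then P u is in W, and as f_i is in S,
      |f_i - P_W f_i| <= |f_i - P u| = |P (f_i - u)| <= |f_i - u|.

    Two analytic facts support this argument. Projections exist because L^2 is
    complete [L2_complete]. For P to commute with U, the operator U must
    preserve orthogonality [U_perp]. By polarization this holds as soon as
    |U f|^2 = c |f|^2 for some constant c [U_sqnorm], so it is enough that an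
    additive homeomorphism of R^d multiplies Lebesgue measure by a constant
    [measure_scaling]. That is the argument for the uniqueness of Haar measure:
    translation invariance and one application of Tonelli's theorem
    [haar_symmetry].

    Functions are representatives, and [proj] picks one of several almost
    everywhere equal projections. The equality P U = U P and the contraction
    |P h| <= |h| are therefore used in the following form: if p and q are in S
    and h - p is orthogonal to S, then |p| <= |h| [perp_sqnorm_le] and
    |h - p| <= |h - q| [perp_sub_le]. *)

(** * The real inner product on square-integrable functions *)

Section inner_product.
Context {R : realType} {d : nat}.
Local Notation fn := ('rV[R]_d -> R[i]).
Local Notation mu := (@lebesgue_rV R d).
Implicit Types f g h : fn.

(** The real part of f conj(g). Over a complex subspace, orthogonality for the
    real inner product below is the same as orthogonality for [L2inner]
    [L2innerE], and working with real numbers lets [lra] and [nra] do the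
    estimates. *)
Definition rdot f g (x : 'rV[R]_d) : R :=
  complex.Re (f x) * complex.Re (g x) + complex.Im (f x) * complex.Im (g x).

Definition rinner f g : R := (\int[mu]_x rdot f g x)%R.

Definition sqnorm f : R := rinner f f.

Let intD (a b : 'rV[R]_d -> R) : mu.-integrable setT (EFin \o a) ->
  mu.-integrable setT (EFin \o b) -> mu.-integrable setT (EFin \o (a \+ b)).
Proof. by exact: integrableD. Qed.

Let intZ k (a : 'rV[R]_d -> R) : mu.-integrable setT (EFin \o a) ->
  mu.-integrable setT (EFin \o (fun x => k * a x)).
Proof. by exact: integrableZl. Qed.

Lemma rdot_normc f x : rdot f f x = Normc.normc (f x) ^+ 2.
Proof.
rewrite /rdot; case: (f x) => a b /=.
by rewrite sqr_sqrtr ?addr_ge0 ?sqr_ge0// !expr2.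
Qed.

Lemma rdot_ge0 f x : 0 <= rdot f f x.
Proof. by rewrite rdot_normc sqr_ge0. Qed.

Lemma measurable_rdot f g :
  measurable_fun setT (fun x => complex.Re (f x) : R) ->
  measurable_fun setT (fun x => complex.Im (f x) : R) ->
  measurable_fun setT (fun x => complex.Re (g x) : R) ->
  measurable_fun setT (fun x => complex.Im (g x) : R) ->
  measurable_fun setT (rdot f g).
Proof. by move=> *; apply: measurable_funD; apply: measurable_funM. Qed.

Lemma L2norm_sq f : (L2norm f ^+ 2 = \int[mu]_x (rdot f f x)%:E)%E.
Proof.
transitivity (L2norm f `^ 2)%E.
  have : (0 <= L2norm f)%E by exact: Lnorm_ge0.
  case: (L2norm f) => [r| |] r0 //; last by rewrite poweRyr// expeS mulyy.
  by rewrite poweR_EFin powR_mulrn// EFin_expe.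
rewrite /L2norm powR_Lnorm//; apply: eq_integral => x _ /=.
rewrite powR_mulrn// rdot_normc; congr (_%:E).
by rewrite -normrX ger0_norm// sqr_ge0.
Qed.

Lemma L2P f : L2 f <->
  [/\ measurable_fun setT (fun x => complex.Re (f x) : R),
      measurable_fun setT (fun x => complex.Im (f x) : R) &
      (\int[mu]_x (rdot f f x)%:E < +oo)%E].
Proof.
have nE : (L2norm f < +oo)%E = (\int[mu]_x (rdot f f x)%:E < +oo)%E.
  rewrite -L2norm_sq; have : (0 <= L2norm f)%E by exact: Lnorm_ge0.
  case: (L2norm f) => [r| |] // _; first by rewrite -EFin_expe !ltry.
by split=> -[mr mi fi]; split=> //; move: fi; rewrite -nE.
Qed.

Lemma L2_measurable_rdot f g : L2 f -> L2 g -> measurable_fun setT (rdot f g).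
Proof. by move=> [? ? _] [? ? _]; exact: measurable_rdot. Qed.

Lemma integrable_rdotxx f : L2 f -> mu.-integrable setT (EFin \o rdot f f).
Proof.
move=> Lf; apply/integrableP; split.
  by apply/measurable_EFinP; exact: L2_measurable_rdot.
have /L2P[_ _] := Lf.
by under [in X in _ -> X]eq_integral => x _ do rewrite /= ger0_norm ?rdot_ge0//.
Qed.

(** From 2 |ab| <= a^2 + b^2 pointwise. *)
Lemma integrable_rdot f g : L2 f -> L2 g -> mu.-integrable setT (EFin \o rdot f g).
Proof.
move=> Lf Lg.
apply: (@le_integrable _ _ _ _ _ _ _ (EFin \o (fun x => rdot f f x + rdot g g x))) => //.
- by apply/measurable_EFinP; exact: L2_measurable_rdot.
- move=> x _ /=; rewrite lee_fin [leRHS]ger0_norm; last by apply: addr_ge0; exact: rdot_ge0.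
  rewrite /rdot; move: (complex.Re (f x)) (complex.Im (f x)) (complex.Re (g x)) (complex.Im (g x)).
  move=> a b a' b'.
  have := sqr_ge0 (a - a'); have := sqr_ge0 (b - b').
  have := sqr_ge0 (a + a'); have := sqr_ge0 (b + b').
  by rewrite ler_norml; nra.
- by apply: intD; exact: integrable_rdotxx.
Qed.

Lemma sqnorm_ge0 f : 0 <= sqnorm f.
Proof. by apply: Rintegral_ge0 => x _; exact: rdot_ge0. Qed.

Lemma L2norm_sqE f : L2 f -> (L2norm f ^+ 2 = (sqnorm f)%:E)%E.
Proof.
move=> Lf; rewrite L2norm_sq /sqnorm /rinner /Rintegral fineK//.
by apply: integrable_fin_num => //; exact: integrable_rdotxx.
Qed.

Lemma sqnormE (f : fn) : L2 f -> (sqnorm f)%:E = (\int[mu]_x (rdot f f x)%:E)%E.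
Proof. by move=> Lf; rewrite -L2norm_sqE// L2norm_sq. Qed.

Lemma L2norm_lt f (e : R) : 0 < e -> L2 f -> (L2norm f < e%:E)%E = (sqnorm f < e ^+ 2).
Proof.
move=> e0 Lf; have : (0 <= L2norm f)%E by exact: Lnorm_ge0.
have := L2norm_sqE Lf; case: (L2norm f) => [r| |] //=.
case=> <-; rewrite lee_fin lte_fin => r0.
by rewrite -expr2 ltr_pXn2r// nnegrE ltW.
Qed.

Lemma rdot_lin (c : R[i]) f g x :
  rdot (fun x => c * f x + g x) (fun x => c * f x + g x) x <=
  2 * (complex.Re c ^+ 2 + complex.Im c ^+ 2) * rdot f f x + 2 * rdot g g x.
Proof.
rewrite /rdot; case: c (f x) (g x) => [c c'] [a a'] [b b'] /=.
have := sqr_ge0 (c * a - c' * a' - b); have := sqr_ge0 (c * a' + c' * a - b').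
nra.
Qed.

Lemma L2_cst0 : L2 (cst 0 : fn).
Proof.
apply/L2P; split => /=; [exact: measurable_cst|exact: measurable_cst|].
under eq_integral do rewrite /rdot/= !mulr0 addr0.
by rewrite integral0.
Qed.

Lemma L2_lin (c : R[i]) f g : L2 f -> L2 g -> L2 (fun x => c * f x + g x).
Proof.
move=> Lf Lg; have [mf mf' _] := Lf; have [mg mg' _] := Lg.
have m1 : measurable_fun setT (fun x => complex.Re (c * f x + g x) : R).
  rewrite (_ : (fun x => _) = fun x => complex.Re c * complex.Re (f x) -
      complex.Im c * complex.Im (f x) + complex.Re (g x)); last first.
    by apply/funext => x; case: (c) (f x) (g x) => [? ?] [? ?] [? ?].
  by apply: measurable_funD => //; apply: measurable_funB => //; exact: measurable_funM.
have m2 : measurable_fun setT (fun x => complex.Im (c * f x + g x) : R).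
  rewrite (_ : (fun x => _) = fun x => complex.Re c * complex.Im (f x) +
      complex.Im c * complex.Re (f x) + complex.Im (g x)); last first.
    by apply/funext => x; case: (c) (f x) (g x) => [? ?] [? ?] [? ?].
  by apply: measurable_funD => //; apply: measurable_funD => //; exact: measurable_funM.
pose h : fn := fun x => c * f x + g x.
apply/L2P; split=> //; rewrite -/h.
have : mu.-integrable setT (EFin \o rdot h h).
  apply: (@le_integrable _ _ _ _ _ _ _ (EFin \o (fun x => 2 * (complex.Re c ^+ 2 + complex.Im c ^+ 2) * rdot f f x + 2 * rdot g g x))) => //.
  - by apply/measurable_EFinP; exact: measurable_rdot.
  - move=> x _ /=; rewrite lee_fin [leLHS]ger0_norm ?rdot_ge0//.
    by apply: le_trans (ler_norm _); exact: rdot_lin.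
  - by apply: intD; apply: intZ; exact: integrable_rdotxx.
move=> /integrableP[_].
by under [in X in X -> _]eq_integral => x _ do rewrite /= ger0_norm ?rdot_ge0//.
Qed.

Lemma L2_add f g : L2 f -> L2 g -> L2 (f \+ g).
Proof.
move=> Lf Lg; have := L2_lin 1 Lf Lg; congr L2.
by apply/funext => x; rewrite mul1r.
Qed.

Lemma L2_sub (f g : fn) : L2 f -> L2 g -> L2 (f \- g).
Proof.
move=> Lf Lg; have := L2_lin (-1) Lg Lf; congr L2.
by apply/funext => x; rewrite mulN1r addrC.
Qed.

Lemma L2_scale (c : R[i]) f : L2 f -> L2 (fun x => c * f x).
Proof.
move=> Lf; have := L2_lin c Lf L2_cst0; congr L2.
by apply/funext => x; rewrite addr0.
Qed.

Lemma rinner_lin (c : R) f g h : L2 f -> L2 g -> L2 h ->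
  rinner (fun x => c%:C%C * f x + g x) h = c * rinner f h + rinner g h.
Proof.
move=> Lf Lg Lh; rewrite /rinner -RintegralZl//; last exact: integrable_rdot.
rewrite -RintegralD//; last exact: integrable_rdot.
  apply: eq_Rintegral => x _; rewrite /rdot.
  by case: (f x) (g x) (h x) => [a a'] [b b'] [e e'] /=; ring.
by apply: intZ; exact: integrable_rdot.
Qed.

Lemma rinnerC f g : rinner f g = rinner g f.
Proof. by apply: eq_Rintegral => x _; rewrite /rdot mulrC [X in _ + X]mulrC. Qed.

Lemma rinner_conj (c : R[i]) f g :
  rinner (fun x => c * f x) g = rinner f (fun x => conjc c * g x).
Proof.
apply: eq_Rintegral => x _; rewrite /rdot.
by case: c (f x) (g x) => [? ?] [? ?] [? ?] /=; ring.
Qed.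

Lemma L2innerE f g :
  L2inner f g = Complex (rinner f g) (rinner f (fun x => 'i%C * g x)).
Proof.
congr Complex; apply: eq_Rintegral => x _; rewrite /rdot;
by case: (f x) (g x) => [a b] [a' b'] /=; ring.
Qed.

Lemma rinnerBl f g h : L2 f -> L2 g -> L2 h ->
  rinner (f \- g) h = rinner f h - rinner g h.
Proof.
move=> Lf Lg Lh; have := rinner_lin (-1) Lg Lf Lh.
rewrite mulN1r addrC => <-; congr rinner; apply/funext => x.
by rewrite rmorphN rmorph1 mulN1r addrC.
Qed.

Lemma rinnerZl (c : R) f h : L2 f -> L2 h ->
  rinner (fun x => c%:C%C * f x) h = c * rinner f h.
Proof.
move=> Lf Lh; have := rinner_lin c Lf L2_cst0 Lh.
have -> : rinner (cst 0 : fn) h = 0.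
  have := rinnerBl Lh Lh Lh; rewrite subrr => <-; congr rinner.
  by apply/funext => x; rewrite /= subrr.
rewrite addr0 => <-; congr rinner; apply/funext => x.
by rewrite addr0.
Qed.

Lemma sqnorm_lin (c : R) f g : L2 f -> L2 g ->
  sqnorm (fun x => c%:C%C * f x + g x) =
  c ^+ 2 * sqnorm f + 2 * c * rinner f g + sqnorm g.
Proof.
move=> Lf Lg; have Lfg := L2_lin c%:C%C Lf Lg.
rewrite /sqnorm rinner_lin// (rinnerC f) (rinnerC g) !rinner_lin//.
by rewrite (rinnerC g f); ring.
Qed.

Lemma sqnormD f g : L2 f -> L2 g ->
  sqnorm (f \+ g) = sqnorm f + 2 * rinner f g + sqnorm g.
Proof.
move=> Lf Lg; have := sqnorm_lin 1 Lf Lg.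
rewrite expr1n mul1r mulr1 => <-; congr sqnorm.
by apply/funext => x; rewrite mul1r.
Qed.

Lemma sqnormB f g : L2 f -> L2 g ->
  sqnorm (f \- g) = sqnorm f - 2 * rinner f g + sqnorm g.
Proof.
move=> Lf Lg.
have -> : f \- g = fun x => (-1)%:C%C * g x + f x.
  by apply/funext => x; rewrite rmorphN rmorph1 mulN1r addrC.
by rewrite sqnorm_lin// rinnerC; ring.
Qed.

Lemma sqnorm_subC f g : L2 f -> L2 g -> sqnorm (f \- g) = sqnorm (g \- f).
Proof. by move=> Lf Lg; rewrite !sqnormB// (rinnerC g); ring. Qed.

(** A substitute for the triangle inequality that stays with squared norms:
    the weight e is free, so the first term can be kept almost unchanged. It
    expands |e f - g|^2 >= 0. *)
Lemma sqnormD_le f g (e : R) : 0 < e -> L2 f -> L2 g ->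
  sqnorm (f \+ g) <= (1 + e) * sqnorm f + (1 + e^-1) * sqnorm g.
Proof.
move=> e0 Lf Lg; rewrite sqnormD//.
have := sqnorm_ge0 (fun x => (- e)%:C%C * f x + g x).
rewrite sqnorm_lin// => h.
have : 0 <= e^-1 * ((- e) ^+ 2 * sqnorm f + 2 * - e * rinner f g + sqnorm g).
  by rewrite mulr_ge0// invr_ge0 ltW.
rewrite (_ : e^-1 * _ = e * sqnorm f - 2 * rinner f g + e^-1 * sqnorm g); first lra.
by field; rewrite gt_eqF.
Qed.

Lemma sqnorm_sub_le f g h : L2 f -> L2 g -> L2 h ->
  sqnorm (f \- h) <= 2 * sqnorm (f \- g) + 2 * sqnorm (g \- h).
Proof.
move=> Lf Lg Lh.
have := sqnormD_le ltr01 (L2_sub Lf Lg) (L2_sub Lg Lh).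
rewrite invr1 (_ : 1 + 1 = 2 :> R)// => /(le_trans _); apply.
rewrite (_ : (f \- g) \+ (g \- h) = f \- h)//.
by apply/funext => x /=; rewrite addrA subrK.
Qed.

Lemma sqnorm_lin_le (c : R[i]) f g : L2 f -> L2 g ->
  sqnorm (fun x => c * f x + g x) <=
  2 * (complex.Re c ^+ 2 + complex.Im c ^+ 2) * sqnorm f + 2 * sqnorm g.
Proof.
move=> Lf Lg.
have := sqnormD_le ltr01 (L2_scale c Lf) Lg.
rewrite invr1 (_ : 1 + 1 = 2 :> R)// => /le_trans; apply; rewrite lerD2r.
rewrite -mulrA ler_pM2l// le_eqVlt; apply/orP; left; apply/eqP.
rewrite {1}/sqnorm /rinner -RintegralZl//; last exact: integrable_rdotxx.
apply: eq_Rintegral => x _; rewrite /rdot.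
by case: c (f x) => [? ?] [? ?] /=; ring.
Qed.

End inner_product.

(** * Completeness of L^2 *)

Lemma limn_einf_le (R : realType) (u : (\bar R)^nat) (c : \bar R) :
  (forall n, (u n <= c)%E) -> (limn_einf u <= c)%E.
Proof.
move=> uc; rewrite limn_einf_lim; apply: lime_le; first exact: is_cvg_einfs.
apply: nearW => n; apply: le_trans (uc n).
by apply: ereal_inf_lbound; exists n => /=.
Qed.

(** The pointwise half of Riesz-Fischer. From 0 <= (2^n s - 1/2)^2 one gets
    s <= 2^n s^2 + 2^-n, so square increments that are summable with weights 2^n
    make the increments themselves summable. In this form the hypothesis can be
    checked by integrating a series of squares term by term. *)
Lemma is_cvg_sum_weighted_sq (R : realType) (a D : R^nat) :
  (forall n, (a n.+1 - a n) ^+ 2 <= D n) ->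
  (\sum_(n <oo) (2 ^+ n * D n)%:E < +oo)%E -> cvgn a.
Proof.
move=> aD Doo.
have D0 n : 0 <= D n by apply: le_trans (aD n); exact: sqr_ge0.
have D20 n : 0 <= 2 ^+ n * D n by apply: mulr_ge0 => //; exact: exprn_ge0.
set G := (\sum_(n <oo) _)%E in Doo.
have G0 : (0 <= G)%E by apply: nneseries_ge0 => n _ _; rewrite lee_fin.
have cD : cvgn (series (fun n => 2 ^+ n * D n)).
  apply: nondecreasing_is_cvgn.
    by apply/nondecreasing_seqP => n; rewrite seriesSr lerDl.
  exists (fine G) => _ [n _ <-].
  rewrite -lee_fin fineK ?ge0_fin_numE// /series/= -sumEFin.
  by apply: nneseries_lim_ge => k _ _; rewrite lee_fin.
have cg : cvgn (series (fun n => (2 ^-1) ^+ n : R)).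
  have := @is_cvg_geometric_series R 1 2^-1.
  rewrite (_ : geometric _ _ = (fun n => (2 ^-1) ^+ n : R)); last first.
    by apply/funext => n; rewrite /geometric /= mul1r.
  by apply; rewrite ger0_norm// invf_lt1// ltr1n.
have cs : cvgn (series (telescope a)).
  apply: normed_cvg.
  apply: (@series_le_cvg _ _ (fun n => 2 ^+ n * D n + (2 ^-1) ^+ n)) => [n|n|n|].
  - exact: normr_ge0.
  - by apply: addr_ge0 => //; exact: exprn_ge0.
  - rewrite /telescope /=.
    set t := a n.+1 - a n; have : t ^+ 2 <= D n by exact: aD.
    rewrite -real_normK ?num_real//; set s := `|t| => sD.
    have e0 : 0 < (2 : R) ^+ n by exact: exprn_gt0.
    rewrite exprVn; set e := 2 ^+ n in e0 *.
    apply: (@le_trans _ _ (e * s ^+ 2 + e^-1)); last by rewrite lerD2r ler_pM2l.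
    have -> : e * s ^+ 2 + e^-1 = s + e^-1 * ((e * s - 2^-1) ^+ 2 + 3 / 4).
      by field; rewrite gt_eqF.
    rewrite lerDl; apply: mulr_ge0; first by rewrite invr_ge0 ltW.
    by apply: addr_ge0; [exact: sqr_ge0|lra].
  - by rewrite -[X in series X]/((_ : R^nat) + _) seriesD; apply: is_cvgD.
rewrite (_ : a = cst (a 0%N) + series (telescope a)).
  by apply: is_cvgD => //; exact: is_cvg_cst.
by apply/funext => n; exact: eq_sum_telescope.
Qed.

Section completeness.
Context {R : realType} {d : nat}.
Local Notation fn := ('rV[R]_d -> R[i]).
Local Notation mu := (@lebesgue_rV R d).

(** The hypothesis bounds every later term, not only the next one, so that
    Fatou's lemma gives the distance to the limit at once; the minimizing
    sequences of [nearest_exists] satisfy it. *)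
Lemma L2_complete (h : nat -> fn) : (forall n, L2 (h n)) ->
  (forall n k, sqnorm (h (n + k)%N \- h n) <= (4 ^-1) ^+ n) ->
  exists g, L2 g /\ forall n, sqnorm (g \- h n) <= (4 ^-1) ^+ n.
Proof.
move=> Lh hC.
pose D n := rdot (h n.+1 \- h n) (h n.+1 \- h n).
have D0 n x : 0 <= D n x by exact: rdot_ge0.
have mD n : measurable_fun setT (D n).
  by apply: L2_measurable_rdot; apply: L2_sub.
have w0 n x : (0 <= (2 ^+ n * D n x)%:E)%E.
  by rewrite lee_fin; apply: mulr_ge0 => //; exact: exprn_ge0.
have mw n : measurable_fun setT (fun x => (2 ^+ n * D n x)%:E).
  by apply/measurable_EFinP; apply: measurable_funM.
(* The terms of this series have integrals at most 2^n 4^-n = 2^-n, so it is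
   integrable, and finite outside of the null set ~` F below. *)
pose G x := (\sum_(n <oo) (2 ^+ n * D n x)%:E)%E.
have mG : measurable_fun setT G.
  by apply: ge0_emeasurable_sum.
have G0 x : (0 <= G x)%E by apply: nneseries_ge0.
have Goo : (\int[mu]_x G x < +oo)%E.
  rewrite integral_nneseries//; apply: (@le_lt_trans _ _ 2%:E); last exact: ltry.
  apply: le_trans (epsilon_trick0 xpredT (ler0n R 2)).
  apply: lee_nneseries => [n _ _|n _]; first exact: integral_ge0.
  under eq_integral do rewrite EFinM.
  rewrite ge0_integralZl//; last 2 first.
  - by apply/measurable_EFinP.
  - by move=> x _; rewrite lee_fin.
  rewrite -sqnormE; last exact: L2_sub.
  rewrite -EFinM lee_fin.
  have := hC n 1%N; rewrite addn1 => hn.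
  apply: (@le_trans _ _ (2 ^+ n * (4 ^-1) ^+ n)); first by rewrite ler_pM2l// exprn_gt0.
  by rewrite -exprMn (_ : 2 * 4^-1 = 2^-1 :> R); [rewrite natrX exprS invfM mulrA divff// mul1r exprVn|lra].
pose F := [set x | (G x < +oo)%E].
have mF : measurable F.
  by rewrite -[F]setTI; exact: emeasurable_fun_infty_o.
have muF : mu (~` F) = 0%E.
  have : mu.-integrable setT G.
    apply/integrableP; split=> //.
    by under eq_integral => x _ do rewrite gee0_abs//.
  move=> /(integrable_ae measurableT) aeG.
  apply/negligibleP; first exact: measurableC.
  apply: negligibleS aeG => x /= Fx Gx.
  by apply: Fx; rewrite /F/= ltey_eq Gx.
have cvgh (part : R[i] -> R) (partB : forall a b, part (a - b) = part a - part b)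
    (part_le : forall (f : fn) x, part (f x) ^+ 2 <= rdot f f x :> R) x :
    F x -> cvgn (fun n => part (h n x)).
  move=> Fx; apply: (is_cvg_sum_weighted_sq (D := D ^~ x)) => // n.
  by rewrite -partB; exact: (part_le (h n.+1 \- h n)).
have ReB (a b : R[i]) : complex.Re (a - b) = complex.Re a - complex.Re b.
  by case: a b => [? ?] [? ?].
have ImB (a b : R[i]) : complex.Im (a - b) = complex.Im a - complex.Im b.
  by case: a b => [? ?] [? ?].
have cRe : forall x, F x -> cvgn (fun n => complex.Re (h n x) : R).
  by apply: cvgh => // f x; rewrite /rdot !expr2 lerDl -expr2 sqr_ge0.
have cIm : forall x, F x -> cvgn (fun n => complex.Im (h n x) : R).
  by apply: cvgh => // f x; rewrite /rdot !expr2 lerDr -expr2 sqr_ge0.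
(* Multiplying by the indicator of F makes the sequence converge everywhere, so
   that the limit is measurable. *)
pose lm (part : R[i] -> R) x := \1_F x * limn (fun n => part (h n x)).
have mlm (part : R[i] -> R) : (forall x, F x -> cvgn (fun n => part (h n x))) ->
    (forall n, measurable_fun setT (fun x => part (h n x))) ->
    measurable_fun setT (lm part).
  move=> cp mp; apply: (@measurable_fun_cvg _ _ _ setT (fun n x => \1_F x * part (h n x))).
    by move=> n; apply: measurable_funM.
  move=> x _; rewrite /lm indicE; case: (boolP (x \in F)) => Fx.
    under eq_fun do rewrite mul1r.
    by rewrite mul1r; apply: cp; apply/set_mem.
  by under eq_fun do rewrite mul0r; rewrite mul0r; exact: cvg_cst.
pose g : fn := fun x => Complex (lm (@complex.Re R) x) (lm (@complex.Im R) x).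
have mg1 : measurable_fun setT (fun x => complex.Re (g x) : R).
  by apply: (mlm (@complex.Re R)) => // n; have [] := Lh n.
have mg2 : measurable_fun setT (fun x => complex.Im (g x) : R).
  by apply: (mlm (@complex.Im R)) => // n; have [] := Lh n.
have gB n : measurable_fun setT (fun x => complex.Re ((g \- h n) x) : R) /\
    measurable_fun setT (fun x => complex.Im ((g \- h n) x) : R).
  have [? ? _] := Lh n; split.
    by under eq_fun do rewrite ReB; apply: measurable_funB.
  by under eq_fun do rewrite ImB; apply: measurable_funB.
have mgB n : measurable_fun setT (rdot (g \- h n) (g \- h n)).
  by have [? ?] := gB n; exact: measurable_rdot.
have cvgg n x : F x -> (fun k => rdot (h (n + k)%N \- h n) (h (n + k)%N \- h n) x) @ \oo -->
    rdot (g \- h n) (g \- h n) x.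
  move=> Fx.
  have lE (part : R[i] -> R) : cvgn (fun n => part (h n x)) ->
      (fun k => part (h (n + k)%N x)) @ \oo --> lm part x.
    move=> cp; rewrite /lm indicE mem_set// mul1r.
    under eq_fun do rewrite addnC; have := cp; rewrite -(cvg_shiftn n); exact.
  have := lE _ (cRe x Fx); have := lE _ (cIm x Fx).
  move=> cI cR; rewrite /rdot.
  under eq_fun do rewrite !ReB !ImB.
  rewrite !ReB !ImB.
  by apply: cvgD; apply: cvgM; apply: cvgB => //; exact: cvg_cst.
have gh n : (\int[mu]_x (rdot (g \- h n) (g \- h n) x)%:E <= ((4 ^-1) ^+ n)%:E)%E.
  rewrite (@ge0_negligible_integral _ _ _ _ _ (~` F))//; last 3 first.
  - exact: measurableC.
  - by apply/measurable_EFinP.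
  - by move=> x _; rewrite lee_fin rdot_ge0.
  rewrite setTD setCK.
  pose q k x := (rdot (h (n + k)%N \- h n) (h (n + k)%N \- h n) x)%:E.
  have mq k : measurable_fun setT (q k).
    by apply/measurable_EFinP; apply: L2_measurable_rdot; exact: L2_sub.
  have q0 k x : (0 <= q k x)%E by rewrite lee_fin rdot_ge0.
  rewrite (eq_integral (fun x => limn_einf (q ^~ x))); last first.
    move=> x /set_mem Fx.
    have /cvg_limn_einf_sup[-> _] // : q ^~ x @ \oo --> (rdot (g \- h n) (g \- h n) x)%:E.
    by apply: cvg_EFin; [exact: nearW|exact: cvgg].
  apply: le_trans (fatou _ _ _ _) _ => //.
    by move=> k; exact: measurable_funTS.
  apply: limn_einf_le => k.
  apply: (@le_trans _ _ (\int[mu]_x q k x)%E).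
    by apply: ge0_subset_integral.
  by rewrite -sqnormE ?lee_fin//; exact: L2_sub.
(* The Fatou bound also shows that g is in L^2, as the sum of g - h 0 and h 0. *)
have LgB n : L2 (g \- h n).
  by have [? ?] := gB n; apply/L2P; split=> //; apply: le_lt_trans (gh n) _; exact: ltry.
exists g; split.
  have := L2_lin 1 (LgB 0%N) (Lh 0%N); congr L2.
  by apply/funext => x; rewrite mul1r subrK.
by move=> n; rewrite -lee_fin sqnormE.
Qed.

End completeness.

(** * Projections onto closed subspaces *)

Section projection.
Context {R : realType} {d : nat}.
Local Notation fn := ('rV[R]_d -> R[i]).
Local Notation proj := (@Defs.proj R d).
Implicit Types f g p s w : fn.
Implicit Types B S W : set fn.

Lemma exp_half_small (e : R) : 0 < e -> exists n, (2 ^-1) ^+ n < e.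
Proof.
move=> e0; pose n := Num.bound e^-1.
have en : e^-1 < n%:R by rewrite archi_boundP// invr_ge0 ltW.
exists n; rewrite exprVn -[ltRHS]invrK ltf_pV2 ?posrE ?invr_gt0 ?exprn_gt0//.
by apply: lt_trans en _; rewrite -natrX ltr_nat ltn_expl.
Qed.

Lemma L2closureP (B : set fn) : B `<=` @L2 R d ->
  L2closure B = [set f | L2 f /\ forall e : R, 0 < e -> exists2 g, B g & sqnorm (f \- g) < e].
Proof.
move=> BL; apply/seteqP; split=> f [Lf fB]; split=> // e e0.
  have se0 : 0 < Num.sqrt e by rewrite sqrtr_gt0.
  have [g Bg] := fB _ se0; rewrite L2norm_lt//; last exact/L2_sub/BL.
  by rewrite sqr_sqrtr ?ltW// => ?; exists g.
have [|g Bg fg] := fB (e ^+ 2); first exact: exprn_gt0.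
by exists g => //; rewrite L2norm_lt//; exact/L2_sub/BL.
Qed.

Lemma closed_subspace_approx (W : set fn) f : closed_subspace W -> L2 f ->
  (forall e : R, 0 < e -> exists2 g, W g & sqnorm (f \- g) < e) -> W f.
Proof. by move=> [WL _ _ Wc] Lf fW; apply: Wc; rewrite L2closureP. Qed.

Lemma closed_subspaceB (W : set fn) f g : closed_subspace W -> W f -> W g -> W (f \- g).
Proof.
move=> [_ _ Wl _] Wf Wg; have := Wl (-1) _ _ Wg Wf; congr W.
by apply/funext => x; rewrite mulN1r addrC.
Qed.

Lemma closed_subspaceZ (W : set fn) c f : closed_subspace W -> W f -> W (fun x => c * f x).
Proof.
move=> [_ W0 Wl _] Wf; have := Wl c _ _ Wf W0; congr W.
by apply/funext => x; rewrite addr0.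
Qed.

(** A minimizing sequence is Cauchy by the parallelogram identity, applied to
    the midpoint of two of its terms. *)
Lemma nearest_exists (W : set fn) f : closed_subspace W -> L2 f ->
  exists2 p, W p & forall w, W w -> sqnorm (f \- p) <= sqnorm (f \- w).
Proof.
move=> cW Lf; have [WL W0 Wl _] := cW.
pose S := [set sqnorm (f \- w) | w in W].
have infS : has_inf S.
  split; first by exists (sqnorm (f \- cst 0)); exists (cst 0).
  by exists 0 => _ [w _ <-]; exact: sqnorm_ge0.
pose dl := inf S.
have dlw w : W w -> dl <= sqnorm (f \- w).
  by move=> Ww; apply: ge_inf; [exact: infS.2|exists w].
have e0 n : 0 < (4 ^-1) ^+ n / 4 :> R by rewrite divr_gt0// exprn_gt0// invr_gt0.
have wex n : {w | W w /\ sqnorm (f \- w) < dl + (4 ^-1) ^+ n / 4}.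
  apply: cid; have [_ [w Ww <-] ?] := inf_adherent (e0 n) infS.
  by exists w.
pose w n := sval (wex n).
have Ww n : W (w n) by exact: (svalP (wex n)).1.
have wS n : sqnorm (f \- w n) < dl + (4 ^-1) ^+ n / 4 by exact: (svalP (wex n)).2.
have Lw n : L2 (w n) by exact: WL.
have wC n k : sqnorm (w (n + k)%N \- w n) <= (4 ^-1) ^+ n.
  pose a := f \- w n; pose b := f \- w (n + k)%N.
  have La : L2 a by exact: L2_sub.
  have Lb : L2 b by exact: L2_sub.
  have -> : w (n + k)%N \- w n = a \- b.
    by apply/funext => x; rewrite /a /b /=; ring.
  pose mid : fn := fun x => 2^-1 * w n x + 2^-1 * w (n + k)%N x.
  have Wmid : W mid by apply: Wl => //; exact: closed_subspaceZ.
  have := dlw _ Wmid.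
  have abE : a \+ b = fun x => (2 : R)%:C%C * (f \- mid) x.
    apply/funext => x; rewrite /a /b /mid /= rmorph_nat.
    by field.
  have := sqnormD La Lb; rewrite abE /sqnorm rinnerZl//; last first.
  - by apply: L2_scale; apply: L2_sub => //; exact: WL.
  - by apply: L2_sub => //; exact: WL.
  rewrite rinnerC rinnerZl//; last first.
  - by apply: L2_sub => //; exact: WL.
  - by apply: L2_sub => //; exact: WL.
  rewrite -!/(sqnorm _) (sqnormB La Lb).
  have := wS n; have := wS (n + k)%N; rewrite -/a -/b.
  have : (4^-1) ^+ (n + k) <= (4^-1) ^+ n :> R.
    by rewrite exprD ler_piMr ?exprn_ge0// exprn_ile1//; lra.
  lra.
have [p [Lp pw]] := L2_complete Lw wC.
have Wp : W p.
  apply: closed_subspace_approx => // e /exp_half_small[n ne]; exists (w n) => //.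
  apply: le_lt_trans (pw n) _; apply: le_lt_trans ne.
  by apply: lerXn2r; rewrite ?nnegrE; lra.
exists p => // v Wv; apply: le_trans (dlw _ Wv).
(* The weight 2^-n in [sqnormD_le] balances the two errors: the second term is
   (1 + 2^n) 4^-n, still of order 2^-n. *)
have pS n : sqnorm (f \- p) <= dl + (2 ^-1) ^+ n * (dl + 3).
  set t := 2 ^-1 ^+ n.
  have t0 : 0 < t by rewrite exprn_gt0.
  have t1 : t <= 1 by rewrite exprn_ile1//; lra.
  have t2 : (4^-1) ^+ n = t ^+ 2 by rewrite -exprM mulnC exprM; congr (_ ^+ _); lra.
  have := sqnormD_le t0 (L2_sub Lf (Lw n)) (L2_sub (Lw n) Lp).
  rewrite (_ : (f \- w n) \+ (w n \- p) = f \- p); last first.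
    by apply/funext => x /=; rewrite addrA subrK.
  rewrite [sqnorm (w n \- p)]sqnorm_subC//.
  move=> /le_trans; apply.
  have a1 := wS n; have a2 := pw n; rewrite t2 in a1 a2.
  have i0 : 0 < 1 + t^-1 by rewrite addr_gt0// invr_gt0.
  have b1 : (1 + t) * sqnorm (f \- w n) <= (1 + t) * (dl + t ^+ 2 / 4).
    by rewrite ler_pM2l ?ltW// addr_gt0.
  have b2 : (1 + t^-1) * sqnorm (p \- w n) <= (1 + t^-1) * t ^+ 2 by rewrite ler_pM2l.
  have b3 : (1 + t^-1) * t ^+ 2 = t ^+ 2 + t by field; rewrite gt_eqF.
  apply: le_trans (lerD b1 b2) _; rewrite b3.
  nra.
rewrite leNgt; apply/negP => dlt.
have dl0 : 0 < dl + 3.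
  suff : 0 <= dl by lra.
  by apply: lb_le_inf; [exact: infS.1|move=> _ [? _ <-]; exact: sqnorm_ge0].
have [n] : exists n, (2^-1) ^+ n < (sqnorm (f \- p) - dl) / (dl + 3).
  by apply: exp_half_small; rewrite divr_gt0// subr_gt0.
by rewrite ltr_pdivlMr// ltrBrDl ltNge pS.
Qed.

Definition perp S f := forall s, S s -> rinner f s = 0.

(** The quadratic t |-> |f - p - t w|^2 has its minimum at t = 0, so its linear
    coefficient vanishes. *)
Lemma orthogonal_of_nearest W f p : closed_subspace W -> L2 f -> W p ->
  (forall w, W w -> sqnorm (f \- p) <= sqnorm (f \- w)) ->
  forall w, W w -> rinner (f \- p) w = 0.
Proof.
move=> [WL W0 Wl _] Lf Wp pmin w Ww.
have Lp := WL _ Wp; have Lw := WL _ Ww; have Lfp := L2_sub Lf Lp.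
set r := rinner _ _.
have key t : 0 <= t ^+ 2 * sqnorm w - 2 * t * r.
  have Wpt : W (fun x => t%:C%C * w x + p x) by exact: Wl.
  have := pmin _ Wpt.
  rewrite (_ : f \- (fun x => t%:C%C * w x + p x) = fun x => (- t)%:C%C * w x + (f \- p) x); last first.
    by apply/funext => x /=; rewrite rmorphN mulNr opprD addrCA.
  by rewrite sqnorm_lin// (rinnerC w) -/r; lra.
have qw := sqnorm_ge0 w.
have s0 : 0 < sqnorm w + 1 by lra.
(* The minimizer r / |w|^2, with 1 added so that w may be null. *)
have := key (r / (sqnorm w + 1)).
rewrite (_ : _ - _ = - (r / (sqnorm w + 1)) ^+ 2 * (sqnorm w + 2)); last first.
  by field; rewrite gt_eqF.
rewrite mulNr oppr_ge0 pmulr_lle0; last lra.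
move=> h; have : (r / (sqnorm w + 1)) ^+ 2 == 0 by rewrite eq_le h sqr_ge0.
by rewrite sqrf_eq0 mulf_eq0 invr_eq0 [_ + 1 == 0]gt_eqF// orbF => /eqP.
Qed.

(** The value chosen by [xget] in [proj] has the defining property because some
    function has it. Being orthogonal to 'i w as well as to w gives complex
    orthogonality. *)
Lemma proj_spec W f : closed_subspace W -> L2 f ->
  W (proj W f) /\ perp W (f \- proj W f).
Proof.
move=> cW Lf; have [p Wp pmin] := nearest_exists cW Lf.
have po := orthogonal_of_nearest cW Lf Wp pmin.
have : exists p, W p /\ forall w, W w -> L2inner (f \- p) w = 0.
  exists p; split=> // w Ww; rewrite L2innerE !po//.
  exact: closed_subspaceZ.
move=> /(xgetPex (cst 0)) [Wq qo]; split=> // w Ww.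
by have := qo _ Ww; rewrite L2innerE => -[].
Qed.

(** Pythagoras for f = (f - g) + g. *)
Lemma perp_sqnorm_le W f g : closed_subspace W -> W g -> L2 f -> perp W (f \- g) ->
  sqnorm g <= sqnorm f.
Proof.
move=> [WL _ _ _] Wg Lf fg; have Lg := WL _ Wg; have Lfg := L2_sub Lf Lg.
have -> : f = (f \- g) \+ g by apply/funext => x; rewrite /= subrK.
by rewrite sqnormD// fg// mulr0 addr0 lerDr sqnorm_ge0.
Qed.

(** Pythagoras for f - w = (f - p) + (p - w). *)
Lemma perp_sub_le W f p w : closed_subspace W -> L2 f -> W p -> W w ->
  perp W (f \- p) -> sqnorm (f \- p) <= sqnorm (f \- w).
Proof.
move=> cW Lf Wp Ww fp; have [WL _ _ _] := cW.
have Lp := WL _ Wp; have Lw := WL _ Ww.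
have -> : f \- w = (f \- p) \+ (p \- w) by apply/funext => x /=; ring.
have Wpw := closed_subspaceB cW Wp Ww.
rewrite (sqnormD (L2_sub Lf Lp) (L2_sub Lp Lw)).
by rewrite fp// mulr0 addr0 lerDl sqnorm_ge0.
Qed.

(** The inner product is only real linear; a complex scalar c is moved onto s,
    as its conjugate, and S absorbs it. *)
Lemma perp_lin S (c : R[i]) f g : closed_subspace S -> L2 f -> L2 g ->
  perp S f -> perp S g -> perp S (fun x => c * f x + g x).
Proof.
move=> cS Lf Lg fS gS s Ss; have [SL _ _ _] := cS.
rewrite (_ : (fun x => _) = fun x => (1 : R)%:C%C * (c * f x) + g x); last first.
  by apply/funext => x; rewrite mul1r.
rewrite rinner_lin//; [|exact: L2_scale|exact: SL].
rewrite rinner_conj gS// fS ?mulr0 ?addr0//.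
exact: closed_subspaceZ.
Qed.

End projection.

(** * Closed spans *)

Section closed_span.
Context {R : realType} {d : nat}.
Local Notation fn := ('rV[R]_d -> R[i]).
Local Notation span := (@Defs.span R d).
Implicit Types f g h : fn.
Implicit Types B W : set fn.

Lemma span0 B : span B (cst 0).
Proof.
exists 0%N, (fun=> 0), (fun=> cst 0); split=> [[]//|].
by apply/funext => x; rewrite big_ord0.
Qed.

Lemma span_lin B (c : R[i]) f g : span B f -> span B g ->
  span B (fun x => c * f x + g x).
Proof.
move=> [n [a [u [Bu ->]]]] [m [b [v [Bv ->]]]].
exists (n + m)%N, (fun i => match fintype.split i with inl j => c * a j | inr j => b j end),
  (fun i => match fintype.split i with inl j => u j | inr j => v j end); split.
  by move=> i; case: fintype.split.
apply/funext => x; rewrite big_split_ord /= mulr_sumr; congr (_ + _).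
  by apply: eq_bigr => i _; rewrite (unsplitK (inl i)) mulrA.
by apply: eq_bigr => i _; rewrite (unsplitK (inr i)).
Qed.

Lemma subset_span B : B `<=` span B.
Proof.
move=> f Bf; exists 1%N, (fun=> 1), (fun=> f); split=> //.
by apply/funext => x; rewrite big_ord1 mul1r.
Qed.

(** Replaces the explicit finite sums in the definition of a span by a
    one-vector-at-a-time induction. *)
Lemma span_ind B (P : fn -> Prop) : P (cst 0) ->
  (forall c b h, B b -> P h -> P (fun x => c * b x + h x)) ->
  forall f, span B f -> P f.
Proof.
move=> P0 PS _ [n [c [u [Bu ->]]]].
elim: n c u Bu => [|n IH] c u Bu.
  by rewrite (_ : (fun x => _) = cst 0)//; apply/funext => x; rewrite big_ord0.
rewrite (_ : (fun x => _) = fun x => c ord0 * u ord0 x +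
    \sum_(i < n) c (lift ord0 i) * u (lift ord0 i) x); last first.
  by apply/funext => x; rewrite big_ord_recl.
by apply: PS => //; apply: (IH (fun i => c (lift ord0 i)) (fun i => u (lift ord0 i))).
Qed.

Lemma span_sub B W : closed_subspace W -> B `<=` W -> span B `<=` W.
Proof. by move=> [_ W0 Wl _] BW; apply: span_ind => // c b h /BW; exact: Wl. Qed.

Lemma span_L2 B : B `<=` @L2 R d -> span B `<=` @L2 R d.
Proof.
by move=> BL; apply: span_ind => [|c b h /BL]; [exact: L2_cst0|exact: L2_lin].
Qed.

Lemma sub_L2closure B : B `<=` @L2 R d -> B `<=` L2closure B.
Proof.
move=> BL f Bf; rewrite L2closureP//; split; first exact: BL.
move=> e e0; exists f => //; have Lf := BL _ Bf.
rewrite sqnormB// (_ : _ + _ = 0)//; rewrite /sqnorm; ring.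
Qed.

Lemma L2closure_sub B W : closed_subspace W -> B `<=` W -> L2closure B `<=` W.
Proof.
move=> cW BW f; have [WL _ _ _] := cW.
rewrite L2closureP; last exact: subset_trans BW WL.
move=> [Lf fB]; apply: closed_subspace_approx => // e /fB[g Bg ge].
by exists g => //; exact: BW.
Qed.

Lemma closed_subspace_closure_span B : B `<=` @L2 R d ->
  closed_subspace (L2closure (span B)).
Proof.
move=> BL; have sL := span_L2 BL; split.
- by move=> f [].
- by apply: sub_L2closure => //; exact: span0.
- move=> c f g; rewrite L2closureP// => -[Lf fB] [Lg gB].
  split; first exact: L2_lin.
  move=> e e0; pose K := complex.Re c ^+ 2 + complex.Im c ^+ 2.
  have K0 : 0 <= K by apply: addr_ge0; exact: sqr_ge0.
  (* By [sqnorm_lin_le] the error is at most 2 K (e / (4 (K + 1))) + 2 (e / 4). *)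
  have [|f' sf' ff'] := fB (e / (4 * (K + 1))); first by rewrite divr_gt0// mulr_gt0//; lra.
  have [|g' sg' gg'] := gB (e / 4); first by rewrite divr_gt0.
  have Lf' := sL _ sf'; have Lg' := sL _ sg'.
  exists (fun x => c * f' x + g' x); first exact: span_lin.
  rewrite (_ : _ \- _ = fun x => c * (f \- f') x + (g \- g') x); last first.
    by apply/funext => x /=; ring.
  apply: le_lt_trans (sqnorm_lin_le _ (L2_sub Lf Lf') (L2_sub Lg Lg')) _.
  rewrite -/K; move: ff'; rewrite ltr_pdivlMr; last lra.
  have := sqnorm_ge0 (f \- f'); move: (sqnorm _) => a a0.
  move: gg'; move: (sqnorm _) => b; nra.
- move=> f; rewrite L2closureP; last by move=> ? [].
  rewrite L2closureP// => -[Lf fB]; split=> // e e0.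
  have [|g [Lg gB] fg] := fB (e / 4); first by rewrite divr_gt0.
  have [|h sh gh] := gB (e / 4); first by rewrite divr_gt0.
  exists h => //; apply: le_lt_trans (sqnorm_sub_le Lf Lg (sL _ sh)) _.
  lra.
Qed.

End closed_span.

(** * Lebesgue measure under translations and additive homeomorphisms *)

Lemma lebesgue_measure_shift (R : realType) (a : R) (A : set R) :
  measurable A -> lebesgue_measure ((fun x => x + a) @^-1` A) = lebesgue_measure A.
Proof.
move=> mA.
have mf : measurable_fun setT (fun x : measurableTypeR R => x + a : measurableTypeR R).
  exact: measurable_funD.
pose nu : {measure set (measurableTypeR R) -> \bar R} :=
  measure_function_pushforward__canonical__measure_function_Measure lebesgue_measure mf.
rewrite -[LHS]/(nu A); apply/esym/lebesgue_measure_unique => // _ [[u v] _ <-] /=.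
rewrite /nu /= /pushforward.
rewrite (_ : _ @^-1` _ = `]u - a, v - a]%classic); last first.
  by apply/seteqP; split => x /=; rewrite !in_itv /= ltrBlDr lerBrDr.
by rewrite !lebesgue_measure_itv /= !lte_fin ltrD2r -!EFinB opprB addrA addrNK.
Qed.

Lemma measurable_rV_shift (R : realType) (n : nat) (a : 'rV[R]_n) :
  measurable_fun setT (fun x : 'rV[R]_n => x + a).
Proof.
apply: measurable_fun_rVP => i; under eq_fun do rewrite mxE.
by apply: measurable_funD => //; exact: measurable_rV_coord.
Qed.

(** By induction on the dimension: the shifted measure is a product measure
    on rectangles, and these determine it. *)
Lemma lebesgue_rV_shift (R : realType) (n : nat) (a : 'rV[R]_n) (A : set 'rV[R]_n) :
  measurable A -> lebesgue_rV n ((fun x => x + a) @^-1` A) = lebesgue_rV n A.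
Proof.
elim: n a A => [|n IH] a A mA.
  by congr (lebesgue_rV 0); apply/seteqP; split=> x /=; rewrite (thinmx0 a) addr0.
rewrite /= /pushforward.
pose a0 := a ord0 ord0; pose a' : 'rV[R]_n := \row_j a ord0 (lift ord0 j).
pose sh (p : measurableTypeR R * 'rV[R]_n) : measurableTypeR R * 'rV[R]_n :=
  (p.1 + a0, p.2 + a').
have msh : measurable_fun setT sh.
  apply: measurable_fun_pair.
    by apply: measurable_funD => //; exact: measurable_fst.
  exact: measurableT_comp (measurable_rV_shift a') measurable_snd.
set P := (lebesgue_measure \x lebesgue_rV n)%E.
pose nu : {measure set (measurableTypeR R * 'rV[R]_n) -> \bar R} :=
  measure_function_pushforward__canonical__measure_function_Measure P msh.
have mcA : measurable (@rV_cons R n @^-1` A).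
  by rewrite -[X in measurable X]setTI; exact: measurable_rV_cons.
transitivity (nu (@rV_cons R n @^-1` A)).
  rewrite /nu /= /pushforward; congr (P _); apply/seteqP; split=> -[x y] /=;
  rewrite (_ : rV_cons (sh (x, y)) = rV_cons (x, y) + a)//;
  apply/rowP => i; case: (unliftP ord0 i) => [j|] ->;
  by rewrite [RHS]mxE !rV_consE /= ?mxE.
apply/esym/product_measure_unique => // X Y mX mY.
rewrite /nu /= /pushforward.
rewrite (_ : sh @^-1` _ = ((fun x => x + a0) @^-1` X) `*` ((fun x => x + a') @^-1` Y))//.
rewrite /P product_measure1E//.
- by congr (_ * _)%E; [exact: lebesgue_measure_shift|exact: IH].
- rewrite -[X in measurable X]setTI; apply: (measurable_funD _ _ measurableT) => //.
- by rewrite -[X in measurable X]setTI; exact: measurable_rV_shift.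
Qed.

Section automorphism.
Context {R : realType} {d : nat}.
Local Notation mu := (@lebesgue_rV R d).
Implicit Types A : 'rV[R]_d -> 'rV[R]_d.

(** The defect h t - t h(1) is additive and vanishes at 1, hence on the
    rationals, hence everywhere by density. *)
Lemma cauchy_equation (h : R -> R) :
  (forall s t, h (s + t) = h s + h t) -> continuous h -> forall t, h t = t * h 1.
Proof.
move=> hD hc t; pose D t := h t - t * h 1.
have DD s r : D (s + r) = D s + D r by rewrite /D hD mulrDl opprD addrACA.
have Dc : continuous D.
  move=> x; apply: cvgB; first exact: hc.
  by apply: cvgMr_tmp; exact: cvg_id.
have D0 : D 0 = 0 by apply: (addrI (D 0)); rewrite -DD !addr0.
have DN s : D (- s) = - D s by apply: (addrI (D s)); rewrite -DD !subrr.
have Dn s n : D (s *+ n) = D s *+ n.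
  by elim: n => [|n IH]; rewrite ?mulr0n// !mulrS DD IH.
have Dz s z : D (s *~ z) = D s *~ z.
  by case: z => n; rewrite ?NegzE ?mulrNz ?DN -!pmulrn Dn.
have Dq q : D (ratr q) = 0.
  have : D (ratr q *~ denq q) = 0.
    rewrite -mulrzr {1}/ratr divfK ?intr_eq0 ?denq_neq0//.
    by rewrite Dz /D mul1r subrr mul0rz.
  by rewrite Dz => /eqP; rewrite mulrz_eq0 denq_eq0 /= => /eqP.
apply/eqP; rewrite -subr_eq0 -/(D t); apply: contrapT => /negP Dt.
have oD : open (D @^-1` [set x | x != 0]).
  by apply: open_comp => [x _|]; [exact: Dc|exact: open_neq].
have [] := @dense_rat R (D @^-1` [set x | x != 0]) _ oD; first by exists t.
by move=> r [/= Dr0 [q _ qr]]; move: Dr0; rewrite -qr Dq eqxx.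
Qed.

Lemma additive_continuous_scale A :
  (forall x y, A (x + y) = A x + A y) -> continuous A ->
  forall t x, A (t *: x) = t *: A x.
Proof.
move=> AD Ac t x; apply/rowP => j; rewrite mxE.
rewrite (cauchy_equation (h := fun t => A (t *: x) ord0 j)).
- by rewrite scale1r.
- by move=> s r; rewrite scalerDl AD mxE.
- have c1 : continuous (fun r : R => r *: x).
    by move=> r; apply: cvgZr_tmp; exact: cvg_id.
  have c2 : continuous (A \o (fun r : R => r *: x)).
    by move=> r; apply: continuous_comp; [exact: c1|exact: Ac].
  have : continuous ((fun M : 'rV[R]_d => M ord0 j) \o (A \o (fun r : R => r *: x))).
    by move=> r; apply: continuous_comp; [exact: c2|exact: coord_continuous].
  exact.
Qed.

Lemma additive_continuous_coord A :
  (forall x y, A (x + y) = A x + A y) -> continuous A ->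
  forall x j, A x ord0 j = \sum_i x ord0 i * A (delta_mx ord0 i) ord0 j.
Proof.
move=> AD Ac x j; have A0 : A 0 = 0 by apply: (addrI (A 0)); rewrite -AD !addr0.
rewrite {1}(row_sum_delta x) (big_morph A AD A0) summxE; apply: eq_bigr => i _.
by rewrite additive_continuous_scale// mxE.
Qed.

(** The measurable structure on row vectors is generated by the coordinates,
    so measurability of A comes from linearity rather than from continuity. *)
Lemma additive_continuous_measurable A :
  (forall x y, A (x + y) = A x + A y) -> continuous A -> measurable_fun setT A.
Proof.
move=> AD Ac; apply: measurable_fun_rVP => j.
under eq_fun do rewrite additive_continuous_coord//.
by apply: measurable_sum => i; apply: measurable_funM => //; exact: measurable_rV_coord.
Qed.

Definition box (a b : 'rV[R]_d) : set 'rV[R]_d :=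
  [set x | forall i, x ord0 i \in `[a ord0 i, b ord0 i]].

Lemma measurable_box a b : measurable (box a b).
Proof.
rewrite (_ : box a b = \bigcap_(i in [set: 'I_d])
    ((fun x : 'rV[R]_d => x ord0 i) @^-1` `[a ord0 i, b ord0 i])).
  apply: fin_bigcap_measurable; first exact: finite_finset.
  move=> i _; rewrite -[X in measurable X]setTI.
  by apply: (measurable_rV_coord i measurableT); exact: measurable_itv.
by apply/seteqP; split=> x Bx i; [move=> _; exact: Bx|exact: (Bx i)].
Qed.

Lemma preimage_measurable (X : 'rV[R]_d -> 'rV[R]_d) (E : set 'rV[R]_d) :
  measurable_fun setT X -> measurable E -> measurable (X @^-1` E).
Proof. by move=> mX mE; rewrite -[X in measurable X]setTI; exact: mX. Qed.

Lemma measurable_rV_lin d' (T : measurableType d') (e : R) (u v : T -> 'rV[R]_d) :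
  measurable_fun setT u -> measurable_fun setT v ->
  measurable_fun setT (fun x => u x + e *: v x).
Proof.
move=> mu_ mv; apply: measurable_fun_rVP => j; under eq_fun do rewrite !mxE.
apply: measurable_funD; last apply: measurable_funM => //.
  exact: measurableT_comp (measurable_rV_coord j) mu_.
exact: measurableT_comp (measurable_rV_coord j) mv.
Qed.

Lemma ge0_integral_scaling (X : 'rV[R]_d -> 'rV[R]_d) (c : {nonneg R}) (f : 'rV[R]_d -> \bar R) :
  measurable_fun setT X ->
  (forall E, measurable E -> mu (X @^-1` E) = (c%:num%:E * mu E)%E) ->
  measurable_fun setT f -> (forall x, 0 <= f x)%E ->
  (\int[mu]_x f (X x) = c%:num%:E * \int[mu]_x f x)%E.
Proof.
move=> mX muX mf f0.
have := ge0_integral_pushforward mX mu measurableT mf (fun x _ => f0 x).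
rewrite preimage_setT => <-; rewrite -ge0_integral_mscale//.
pose nu : {measure set 'rV[R]_d -> \bar R} :=
  measure_function_pushforward__canonical__measure_function_Measure mu mX.
have mus E : measurable E -> E `<=` setT -> nu E = mscale c mu E.
  by move=> mE _; exact: muX.
exact: (@eq_measure_integral _ _ _ setT (mscale c mu) nu f mus).
Qed.

End automorphism.

Section scaling.
Context {R : realType} {d : nat}.
Local Notation mu := (@lebesgue_rV R d).
Variables A A' : 'rV[R]_d -> 'rV[R]_d.
Hypotheses (AD : forall x y, A (x + y) = A x + A y) (Ac : continuous A).
Hypotheses (A'D : forall x y, A' (x + y) = A' x + A' y) (A'c : continuous A').
Hypotheses (AK : cancel A A') (A'K : cancel A' A).

Let mA : measurable_fun setT A := additive_continuous_measurable AD Ac.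

(** The set measured on the left is a translate, by - A' x, of the one on the
    right. *)
Lemma preimage_shift_measure (x : 'rV[R]_d) (E : set 'rV[R]_d) : measurable E ->
  mu [set y | E (A y + x)] = mu (A @^-1` E).
Proof.
move=> mE; rewrite -[RHS](lebesgue_rV_shift (A' x)); last exact: preimage_measurable.
by congr (mu _); apply/seteqP; split=> y /=; rewrite AD A'K.
Qed.

Lemma indic_fubini (E F : set 'rV[R]_d) (u v : 'rV[R]_d * 'rV[R]_d -> 'rV[R]_d) :
  measurable E -> measurable F ->
  measurable_fun setT u -> measurable_fun setT v ->
  (\int[mu]_x \int[mu]_y (\1_E (u (x, y)) * \1_F (v (x, y)))%:E =
   \int[mu]_y \int[mu]_x (\1_E (u (x, y)) * \1_F (v (x, y)))%:E)%E.
Proof.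
move=> mE mF mu_ mv; apply: (@fubini_tonelli _ _ _ _ _ mu mu (fun z => (\1_E (u z) * \1_F (v z))%:E)).
  apply/measurable_EFinP; apply: measurable_funM.
    exact: measurableT_comp mu_.
  exact: measurableT_comp mv.
by move=> z; rewrite lee_fin mulr_ge0.
Qed.

Lemma int_indicZ (r : R) (E : set 'rV[R]_d) : 0 <= r -> measurable E ->
  (\int[mu]_x (r * \1_E x)%:E = r%:E * mu E)%E.
Proof.
move=> r0 mE; under eq_integral do rewrite EFinM.
rewrite ge0_integralZl//; first by rewrite integral_indic// setIT.
by apply/measurable_EFinP; exact: measurable_indic.
Qed.

Lemma int_indicZr (r : \bar R) (E : set 'rV[R]_d) : (0 <= r)%E -> measurable E ->
  (\int[mu]_x ((\1_E x)%:E * r) = mu E * r)%E.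
Proof.
move=> r0 mE; rewrite ge0_integralZr//; first by rewrite integral_indic// setIT.
by apply/measurable_EFinP; exact: measurable_indic.
Qed.

(** Integrate 1_E(x) 1_F(A y - x) over all pairs (x, y). For x fixed, the
    integral in y is mu (A^-1 F), whence the left-hand side. For y fixed, the
    translation x |-> x + A y turns the integrand into 1_E(A y + x) 1_F(- x);
    integrating this in y first gives the right-hand side. *)
Lemma haar_symmetry (E F : set 'rV[R]_d) : measurable E -> measurable F ->
  (mu E * mu (A @^-1` F) = mu (-%R @^-1` F) * mu (A @^-1` E))%E.
Proof.
move=> mE mF.
have mN : measurable_fun setT (fun x : 'rV[R]_d => - x).
  apply: measurable_fun_rVP => j; under eq_fun do rewrite mxE.
  by apply: measurable_funN; exact: measurable_rV_coord.
have m1 : measurable_fun setT (fst : 'rV[R]_d * 'rV[R]_d -> _) by exact: measurable_fst.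
have m2 : measurable_fun setT (snd : 'rV[R]_d * 'rV[R]_d -> _) by exact: measurable_snd.
have mA2 : measurable_fun setT (fun p : 'rV[R]_d * 'rV[R]_d => A p.2).
  exact: measurableT_comp mA m2.
have mD (e : R) : measurable_fun setT (fun p : 'rV[R]_d * 'rV[R]_d => A p.2 + e *: p.1).
  exact: measurable_rV_lin.
have mNA : measurable (-%R @^-1` F) by exact: preimage_measurable.
(* Subtraction is written with the scalar -1 so that [measurable_rV_lin] serves
   both this integrand and the translated one. *)
transitivity (\int[mu]_x \int[mu]_y (\1_E x * \1_F (A y + (-1) *: x))%:E)%E.
  rewrite -int_indicZr//; apply: eq_integral => x _.
  rewrite -(@preimage_shift_measure ((-1) *: x))// -int_indicZ//.
  apply: preimage_measurable => //.
  exact: measurable_rV_lin _ mA (@measurable_cst _ _ _ _ _ _).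
rewrite (indic_fubini mE mF m1 (mD (-1))).
transitivity (\int[mu]_y \int[mu]_x (\1_E (A y + 1 *: x) * \1_F (- x))%:E)%E.
  apply: eq_integral => y _.
  pose h (x : 'rV[R]_d) : \bar R := (\1_E x * \1_F (A y + (-1) *: x))%:E.
  have mh : measurable_fun setT h.
    apply/measurable_EFinP; apply: measurable_funM => //.
    apply: measurableT_comp => //.
    exact: measurable_rV_lin _ (@measurable_cst _ _ _ _ _ _) (@measurable_id _ _ _).
  have h0 x : (0 <= h x)%E by rewrite lee_fin mulr_ge0.
  have muh (Q : set 'rV[R]_d) : measurable Q ->
      mu ((fun x => x + A y) @^-1` Q) = ((1%:nng : {nonneg R})%:num%:E * mu Q)%E.
    by move=> mQ; rewrite mul1e; exact: lebesgue_rV_shift.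
  have := ge0_integral_scaling (measurable_rV_shift (A y)) muh mh h0.
  rewrite mul1e => <-; apply: eq_integral => x _.
  by rewrite /h scale1r scaleN1r opprD addrCA subrr addr0 addrC.
rewrite -(indic_fubini mE mF (mD 1) (measurableT_comp mN m1)).
rewrite -int_indicZr//; apply: eq_integral => x _.
rewrite -(@preimage_shift_measure (1 *: x))// -int_indicZ//.
  by apply: eq_integral => y _; rewrite mulrC.
apply: preimage_measurable => //.
exact: measurable_rV_lin _ mA (@measurable_cst _ _ _ _ _ _).
Qed.

(** [haar_symmetry] with F the unit cube, whose reflection has measure 1. The
    constant mu (A^-1 F) is finite since A' maps the cube into a bounded box. *)
Lemma measure_scaling : exists c : {nonneg R}, forall E, measurable E ->
  (mu (A @^-1` E) = c%:num%:E * mu E)%E.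
Proof.
pose F : set 'rV[R]_d := box 0 (const_mx 1).
have mF : measurable F by exact: measurable_box.
have NF : mu (-%R @^-1` F) = 1%E.
  rewrite (_ : -%R @^-1` F = box (const_mx (-1)) 0).
    rewrite lebesgue_rV_box; last by move=> i; rewrite !mxE lerN10.
    by rewrite big1// => i _; rewrite !mxE sub0r opprK.
  apply/seteqP; split=> x xF i; have := xF i;
  by rewrite !mxE !in_itv /= => /andP[? ?]; apply/andP; split; lra.
pose K := \sum_(i < d) \sum_(j < d) `|A' (delta_mx ord0 i) ord0 j|.
have K0 : 0 <= K by apply: sumr_ge0 => i _; apply: sumr_ge0.
have AFK : A @^-1` F `<=` box (const_mx (- K)) (const_mx K).
  move=> y /= Fy j; rewrite !mxE in_itv /= -ler_norml.
  rewrite -(AK y) additive_continuous_coord//.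
  apply: le_trans (ler_norm_sum _ _ _) _; apply: ler_sum => i _.
  have := Fy i; rewrite !mxE in_itv /= => /andP[y0 y1].
  rewrite normrM ger0_norm//.
  apply: (@le_trans _ _ `|A' (delta_mx ord0 i) ord0 j|); first by rewrite ler_piMl.
  by rewrite (bigD1 j)//= lerDl; apply: sumr_ge0.
have Foo : (mu (A @^-1` F) < +oo)%E.
  apply: (@le_lt_trans _ _ (mu (box (const_mx (- K)) (const_mx K)))).
    apply: le_measure => //; rewrite inE; [exact: preimage_measurable|exact: measurable_box].
  rewrite lebesgue_rV_box ?ltry// => i; rewrite !mxE; lra.
have c0 : 0 <= fine (mu (A @^-1` F)) by exact: fine_ge0.
exists (NngNum c0) => E mE /=.
rewrite fineK; last by rewrite ge0_fin_numE.
by rewrite muleC (haar_symmetry mE mF) NF mul1e.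
Qed.

End scaling.

(** * The action of Gamma *)

Section composition.
Context {R : realType} {d : nat}.
Local Notation fn := ('rV[R]_d -> R[i]).
Local Notation mu := (@lebesgue_rV R d).
Implicit Types f g : fn.
Variables (X : 'rV[R]_d -> 'rV[R]_d) (c : {nonneg R}).
Hypotheses (mX : measurable_fun setT X)
  (muX : forall E, measurable E -> mu (X @^-1` E) = (c%:num%:E * mu E)%E).

Lemma sqnorm_comp_ereal f : L2 f ->
  (\int[mu]_x (rdot (f \o X) (f \o X) x)%:E = (c%:num * sqnorm f)%:E)%E.
Proof.
move=> Lf; rewrite EFinM sqnormE//.
rewrite -(ge0_integral_scaling mX muX)//.
  by apply/measurable_EFinP; exact: L2_measurable_rdot.
by move=> x; rewrite lee_fin rdot_ge0.
Qed.

Lemma L2_comp f : L2 f -> L2 (f \o X).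
Proof.
move=> Lf; have [mr mi _] := Lf; apply/L2P; split.
- exact: measurableT_comp mr mX.
- exact: measurableT_comp mi mX.
- by rewrite sqnorm_comp_ereal// ltry.
Qed.

Lemma sqnorm_comp f : L2 f -> sqnorm (f \o X) = c%:num * sqnorm f.
Proof.
by move=> Lf; apply: EFin_inj; rewrite sqnormE; [exact: sqnorm_comp_ereal|exact: L2_comp].
Qed.

(** By polarization. *)
Lemma rinner_comp f (g : fn) : L2 f -> L2 g -> rinner (f \o X) (g \o X) = c%:num * rinner f g.
Proof.
move=> Lf Lg; have := sqnorm_comp (L2_add Lf Lg).
have -> : (f \+ g) \o X = (f \o X) \+ (g \o X) by [].
rewrite !sqnormD//; [|exact: L2_comp|exact: L2_comp].
by rewrite !sqnorm_comp//; lra.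
Qed.

End composition.

Section gamma.
Context {R : realType} {d : nat}.
Local Notation fn := ('rV[R]_d -> R[i]).
Local Notation span := (@Defs.span R d).
Local Notation proj := (@Defs.proj R d).
Local Notation mu := (@lebesgue_rV R d).
Context {Lambda : set 'rV[R]_d} {G : groupType} {rho : G -> 'rV[R]_d -> 'rV[R]_d}.
Hypotheses (LambdaP : full_rank_lattice Lambda) (rhoP : lattice_action Lambda rho).
Implicit Types f u : fn.
Implicit Types A S W : set fn.

Local Notation U k g f := (T_op k (R_op rho g f)).

Lemma rhoK g : cancel (rho g) (rho g^-1%g).
Proof. by move=> x; rewrite -(actionM rhoP) mulVg (action1 rhoP). Qed.

Lemma rhoVK g : cancel (rho g^-1%g) (rho g).
Proof. by move=> x; rewrite -(actionM rhoP) mulgV (action1 rhoP). Qed.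

Lemma lattice0 : Lambda 0.
Proof.
have [B _ ->] := LambdaP; exists 0 => //.
by rewrite (_ : map_mx _ _ = 0) ?mul0mx//; apply/matrixP => i j; rewrite !mxE.
Qed.

Lemma latticeD x y : Lambda x -> Lambda y -> Lambda (x + y).
Proof.
have [B _ ->] := LambdaP => -[u _ <-] [v _ <-]; exists (u + v) => //.
by rewrite -mulmxDl; congr mulmx; apply/matrixP => i j; rewrite !mxE intrD.
Qed.

Lemma latticeN x : Lambda x -> Lambda (- x).
Proof.
have [B _ ->] := LambdaP => -[u _ <-]; exists (- u) => //.
by rewrite -mulNmx; congr mulmx; apply/matrixP => i j; rewrite !mxE intrN.
Qed.

Lemma lattice_rho g x : Lambda x -> Lambda (rho g x).
Proof. by move=> Lx; rewrite -(action_lattice rhoP g); exists x. Qed.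

Lemma rho0 g : rho g 0 = 0.
Proof. by apply: (addrI (rho g 0)); rewrite -(action_additive rhoP) !addr0. Qed.

Lemma rhoN g x : rho g (- x) = - rho g x.
Proof. by apply: (addrI (rho g x)); rewrite -(action_additive rhoP) !subrr rho0. Qed.

(** The change of variables behind T_k R_g is a translation followed by
    rho g^-1, so [measure_scaling] applies, with rho g as the inverse. *)
Lemma U_scaling k g : exists2 c : {nonneg R},
  measurable_fun setT (fun x : 'rV[R]_d => rho g^-1%g (x - k)) &
  forall E, measurable E ->
    mu ((fun x : 'rV[R]_d => rho g^-1%g (x - k)) @^-1` E) = (c%:num%:E * mu E)%E.
Proof.
have [c cE] := measure_scaling (action_additive rhoP g^-1%g) (@action_continuous _ _ _ _ _ rhoP g^-1%g)
  (action_additive rhoP g) (@action_continuous _ _ _ _ _ rhoP g) (@rhoVK g) (@rhoK g).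
have mr : measurable_fun setT (rho g^-1%g).
  exact: additive_continuous_measurable (action_additive rhoP _) (@action_continuous _ _ _ _ _ rhoP _).
exists c; first exact: measurableT_comp mr (measurable_rV_shift (- k)).
move=> E mE; rewrite -cE// -[RHS](lebesgue_rV_shift (- k))//.
exact: preimage_measurable.
Qed.

Lemma U_L2 k g f : L2 f -> L2 (U k g f).
Proof. by have [c mX muX] := U_scaling k g; exact: (L2_comp mX muX). Qed.

Lemma U_sqnorm k g : exists2 c : R, 0 <= c & forall f, L2 f -> sqnorm (U k g f) = c * sqnorm f.
Proof.
have [c mX muX] := U_scaling k g; exists c%:num => // f.
exact: (sqnorm_comp mX muX).
Qed.

(** The multiplication of the semidirect product. *)
Lemma U_comp k g k' g' f : U k g (U k' g' f) = U (k + rho g k') (g * g')%g f.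
Proof.
apply/funext => x; rewrite /T_op /R_op invgM (actionM rhoP); congr (f (rho _ _)).
by rewrite -{1}(rhoK g k') -rhoN -(action_additive rhoP) opprD addrA.
Qed.

Lemma U_id f : U 0 1%g f = f.
Proof. by apply/funext => x; rewrite /T_op /R_op invg1 (action1 rhoP) subr0. Qed.

Definition orbit (A : set fn) : set fn := [set h |
  exists k g f, [/\ Lambda k, A f & h = U k g f]].

Definition U_stable (W : set fn) := forall k g f, Lambda k -> W f -> W (U k g f).

Lemma orbit_L2 A : A `<=` @L2 R d -> orbit A `<=` @L2 R d.
Proof. by move=> AL _ [k [g [f [_ /AL Lf ->]]]]; exact: U_L2. Qed.

Lemma sub_orbit A : A `<=` orbit A.
Proof. by move=> f Af; exists 0, 1%g, f; split; [exact: lattice0|by []|rewrite U_id]. Qed.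

(** U multiplies inner products by a constant and S is stable under the inverse
    of U, so <U f, s> is a multiple of <f, U^-1 s> = 0. *)
Lemma U_perp S k g f : closed_subspace S -> U_stable S -> Lambda k ->
  L2 f -> perp S f -> perp S (U k g f).
Proof.
move=> [SL _ _ _] SU Lk Lf fS s Ss; have [c mX muX] := U_scaling k g.
pose s' := U (- rho g^-1%g k) g^-1%g s.
have Ss' : S s' by apply: SU => //; apply/latticeN/lattice_rho.
have -> : s = U k g s'.
  by rewrite /s' U_comp rhoN rhoVK subrr mulgV U_id.
have := rinner_comp mX muX Lf (SL _ Ss').
by rewrite fS// mulr0.
Qed.

Lemma S_GammaE A : S_Gamma Lambda rho A = L2closure (span (orbit A)).
Proof. by []. Qed.

(** Each U sends the span of the orbit to itself, because of [U_comp], and is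
    bounded, so it also preserves the closure. *)
Lemma S_Gamma_invariant A : A `<=` @L2 R d -> Gamma_invariant Lambda rho (S_Gamma Lambda rho A).
Proof.
move=> AL; have oL := orbit_L2 AL; have sL := span_L2 oL.
split; first exact: closed_subspace_closure_span.
move=> k g f Lk; rewrite S_GammaE L2closureP// => -[Lf fA].
split=> [|e e0]; first exact: U_L2.
have [c c0 cE] := U_sqnorm k g.
have [|h sh fh] := fA (e / (c + 1)); first by rewrite divr_gt0//; lra.
have Lh := sL _ sh.
exists (U k g h).
  move: h sh {fh Lh}; apply: span_ind => [|b h h' [k' [g' [a [Lk' Aa ->]]]] sh].
    exact: span0.
  apply: (@span_lin _ _ _ b (U k g (U k' g' a)) (U k g h')) => //.
  apply: subset_span; rewrite U_comp; exists (k + rho g k'), (g * g')%g, a; split=> //.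
  by apply: latticeD => //; exact: lattice_rho.
have -> : U k g f \- U k g h = U k g (f \- h) by [].
rewrite cE; last exact: L2_sub.
move: fh; rewrite ltr_pdivlMr; last lra.
by have := sqnorm_ge0 (f \- h); nra.
Qed.

Lemma sub_S_Gamma A : A `<=` @L2 R d -> A `<=` S_Gamma Lambda rho A.
Proof.
move=> AL f Af; apply: sub_L2closure; first exact/span_L2/orbit_L2.
by apply: subset_span; exact: sub_orbit.
Qed.

Lemma S_Gamma_sub A W : Gamma_invariant Lambda rho W -> A `<=` W ->
  S_Gamma Lambda rho A `<=` W.
Proof.
move=> [cW WU] AW; apply: L2closure_sub => //; apply: span_sub => //.
by move=> _ [k [g [f [Lk /AW Wf ->]]]]; exact: WU.
Qed.

(** The least number of generators exists because the naturals are
    well-ordered, and it is at most the number r of generators given. *)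
Lemma class_C_S_Gamma l r (psi : 'I_r -> fn) : (forall i, L2 (psi i)) -> (r <= l)%N ->
  class_C Lambda rho l (S_Gamma Lambda rho (range psi)).
Proof.
move=> Lpsi rl; have psiL : range psi `<=` @L2 R d by move=> _ [i _ <-].
split; first exact: S_Gamma_invariant.
pose P n := `[< generated_by Lambda rho (S_Gamma Lambda rho (range psi)) n >].
have Pr : P r by apply/asboolP; exists psi.
have exP : exists n, P n by exists r.
case: (ex_minnP exP) => n /asboolP Pn nmin; exists n.
  by split=> // s Ps; apply: nmin; apply/asboolP.
exact: leq_trans (nmin _ Pr) rl.
Qed.

(** The commutation of the projection with the operators U, on the level of
    generators. A combination v of translates U psi_i has a counterpart v' among
    the combinations of the U (P psi_i), with v - v' orthogonal to S by
    [U_perp]. Then P u - v' is the component in S of u - v, so v' is as close to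
    P u as v is to u. *)
Lemma proj_S_Gamma S r (psi : 'I_r -> fn) u : Gamma_invariant Lambda rho S ->
  (forall i, L2 (psi i)) -> S_Gamma Lambda rho (range psi) u ->
  S_Gamma Lambda rho (range (fun i => proj S (psi i))) (proj S u).
Proof.
move=> [cS SU] Lpsi; have [SL _ _ _] := cS.
have psiL : range psi `<=` @L2 R d by move=> _ [i _ <-].
set pr := fun i => proj S (psi i).
have prS i : S (pr i) by exact: (proj_spec cS (Lpsi i)).1.
have prL : range pr `<=` @L2 R d by move=> _ [i _ <-]; exact: SL.
have sL := span_L2 (orbit_L2 psiL); have sL' := span_L2 (orbit_L2 prL).
have sS : span (orbit (range pr)) `<=` S.
  apply: span_sub => // _ [k [g [_ [Lk [i _ <-] ->]]]].
  exact: SU.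
have spanP v : span (orbit (range psi)) v ->
    L2 v /\ exists2 v', span (orbit (range pr)) v' & perp S (v \- v').
  move: v; apply: span_ind => [|c _ h [k [g [_ [Lk [i _ <-] ->]]]] [Lh [h' sh' hh']]].
    split; first exact: L2_cst0.
    exists (cst 0); first exact: span0.
    move=> s Ss; have Ls := SL _ Ss.
    by rewrite rinnerBl ?subrr//; exact: L2_cst0.
  have LU := U_L2 k g (Lpsi i); split; first exact: L2_lin.
  exists (fun x => c * U k g (pr i) x + h' x).
    apply: span_lin => //; apply: subset_span; exists k, g, (pr i); split=> //.
  rewrite (_ : _ \- _ = fun x => c * U k g (psi i \- pr i) x + (h \- h') x); last first.
    by apply/funext => x; rewrite /T_op /R_op /=; ring.
  have Lpr := SL _ (prS i).
  apply: perp_lin => //.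
  - by apply/U_L2/L2_sub.
  - by apply: L2_sub => //; exact: sL'.
  - by apply: U_perp => //; [exact: L2_sub|exact: (proj_spec cS (Lpsi i)).2].
rewrite !S_GammaE (L2closureP sL) => -[Lu uA].
have [Sp up] := proj_spec cS Lu; set p := proj S u in Sp up *.
have Lp := SL _ Sp.
rewrite L2closureP//; split=> // e /uA[v /spanP[Lv [v' sv' vv']] uv].
exists v' => //; apply: le_lt_trans uv.
have Sv' := sS _ sv'; have Lv' := SL _ Sv'.
apply: (perp_sqnorm_le cS).
- exact: closed_subspaceB.
- exact: L2_sub.
rewrite (_ : _ \- _ = fun x => (-1) * (v \- v') x + (u \- p) x); last first.
  by apply/funext => x /=; ring.
by apply: perp_lin => //; exact: L2_sub.
Qed.

End gamma.

(** * The approximation theorem *)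

Theorem proposition4 (R : realType) (d : nat) (Lambda : set 'rV[R]_d)
    (G : groupType) (rho : G -> 'rV[R]_d -> 'rV[R]_d)
    (lattice_Lambda : full_rank_lattice Lambda)
    (countable_G : countable [set: G])
    (action_rho : lattice_action Lambda rho)
    (l : nat) (l_gt0 : (0 < l)%N)
    (m : nat) (f : 'I_m -> 'rV[R]_d -> R[i]) (f_L2 : forall i, L2 (f i))
    (M : set ('rV[R]_d -> R[i])) (M_C : class_C Lambda rho l M) :
  exists W : set ('rV[R]_d -> R[i]),
    [/\ W `<=` S_Gamma Lambda rho (range f),
        class_C Lambda rho l W &
        (error f W <= error f M)%E].
Proof.
have fL : range f `<=` @L2 R d by move=> _ [i _ <-].
have Sinv := S_Gamma_invariant lattice_Lambda action_rho fL; set S := S_Gamma _ _ _ in Sinv *.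
have [cS SU] := Sinv; have [SL _ _ _] := cS.
have [[cM _] [r [[psi [Lpsi ME]] _] rl]] := M_C; have [ML _ _ _] := cM.
pose pr i := Defs.proj S (psi i).
have prS i : S (pr i) by exact: (proj_spec cS (Lpsi i)).1.
pose W := S_Gamma Lambda rho (range pr).
have WS : W `<=` S by apply: S_Gamma_sub => // _ [i _ <-].
have WC : class_C Lambda rho l W.
  by apply: (class_C_S_Gamma lattice_Lambda action_rho) rl => i; exact: SL.
exists W; split=> //.
have [[cW _] _] := WC; have [WL _ _ _] := cW.
apply: lee_sum => i _.
have Lf := f_L2 i; have Sf : S (f i) by apply: (sub_S_Gamma lattice_Lambda action_rho fL); exists i.
have [Wq fq] := proj_spec cW Lf.
have [Mu _] := proj_spec cM Lf; set u := Defs.proj M (f i) in Mu *.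
have Lu := ML _ Mu.
have [Spu upu] := proj_spec cS Lu.
have Wpu : W (Defs.proj S u) by apply: (proj_S_Gamma lattice_Lambda action_rho) => //; rewrite -ME.
have Lq := WL _ Wq; have Lpu := SL _ Spu.
rewrite !L2norm_sqE; [|exact: L2_sub|exact: L2_sub].
rewrite lee_fin; apply: le_trans (perp_sub_le cW Lf Wq Wpu fq) _.
apply: (perp_sqnorm_le cS).
- exact: closed_subspaceB.
- exact: L2_sub.
rewrite (_ : _ \- _ = fun x => (-1) * (u \- Defs.proj S u) x + (cst 0 : 'rV[R]_d -> R[i]) x); last first.
  by apply/funext => x /=; ring.
apply: perp_lin => //; [exact: L2_sub|exact: L2_cst0|].
move=> s Ss; rewrite -(_ : u \- u = cst 0); last by apply/funext => x /=; rewrite subrr.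
by rewrite rinnerBl ?subrr//; exact: SL.
Qed.
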